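(* Let $h>1$ be an integer, $q=2^h$, and let $U$ be a nonempty subset of $\mathrm{GF}(q)^{\star}$ with $|U|<\frac{q}{4}-1$. Then no regular hyperoval $\Omega$ of $AG(2,q^2)$ is an inherited hyperoval of $\mathcal M_U(q^2)$; that is, for every regular hyperoval $\Omega$ of $AG(2,q^2)$, the point set $\Omega$ is not an arc of the projective closure $\overline{\mathcal M_U(q^2)}$ (some line of $\overline{\mathcal M_U(q^2)}$ contains at least three points of $\Omega$).
   Context: For a prime power $q$, the norm is $\|x\|=x^{q+1}$ for $x\in\mathrm{GF}(q^2)$. For a proper subset $U$ of $\mathrm{GF}(q)^{\star}$, define on $\mathrm{GF}(q^2)$ the product $a\odot b=ab$ if $\|b\|\notin U$ and $a\odot b=a^q b$ if $\|b\|\in U$. The affine plane $\mathcal M_U(q^2)$ has as points the points $P(x,y)$ of $AG(2,q^2)$, and as lines the sets $[c]=\{P(x,y): x=c\}$ and $[m,n]=\{P(x,y): y=m\odot x+n\}$ for $c,m,n\in\mathrm{GF}(q^2)$. Its projective closure $\overline{\mathcal M_U(q^2)}$ is obtained by adding one point at infinity per parallel class (lines $[m,n]$ with fixed $m$; the lines $[c]$) and the line at infinity. For $q$ even, a regular hyperoval of $PG(2,q^2)$ is the union of a non-degenerate conic and its nucleus; a regular hyperoval of $AG(2,q^2)$ is one all of whose $q^2+2$ points are affine. An arc is a set of points no three of which are collinear. *)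

(* Defs.v *)
From HB Require Import structures.
From mathcomp Require Import all_boot all_order all_algebra.
Set Implicit Arguments. Unset Strict Implicit. Unset Printing Implicit Defensive.
Import GRing.Theory.
Local Open Scope ring_scope.

Definition vec3 (F : Type) := (F * F * F)%type.

Definition v0 (F : fieldType) : vec3 F := (0, 0, 0).
Definition vadd (F : fieldType) (v w : vec3 F) : vec3 F :=
  (v.1.1 + w.1.1, v.1.2 + w.1.2, v.2 + w.2).
Definition vscale (F : fieldType) (k : F) (v : vec3 F) : vec3 F :=
  (k * v.1.1, k * v.1.2, k * v.2).

Definition peq (F : fieldType) (v w : vec3 F) : Prop :=
  exists2 k : F, k != 0 & w = vscale k v.

Definition on_line (F : fieldType) (l v : vec3 F) : Prop :=
  l.1.1 * v.1.1 + l.1.2 * v.1.2 + l.2 * v.2 = 0.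

Definition qform (F : Type) := (F * F * F * F * F * F)%type.

Definition qeval (F : fieldType) (Q : qform F) (v : vec3 F) : F :=
  let '(a, b, c, d, e, f) := Q in
  let '(x, y, z) := v in
  a * x ^+ 2 + b * y ^+ 2 + c * z ^+ 2 + d * x * y + e * x * z + f * y * z.

Definition qpolar (F : fieldType) (Q : qform F) (v w : vec3 F) : F :=
  qeval Q (vadd v w) - qeval Q v - qeval Q w.

Definition qnondeg (F : fieldType) (Q : qform F) : Prop :=
  forall v : vec3 F, v <> v0 F -> qeval Q v = 0 ->
    ~ (forall w : vec3 F, qpolar Q v w = 0).

Definition tangent_line (F : fieldType) (Q : qform F) (l : vec3 F) : Prop :=
  l <> v0 F /\
  exists v : vec3 F, [/\ v <> v0 F, qeval Q v = 0, on_line l v &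
    forall w : vec3 F, w <> v0 F -> qeval Q w = 0 -> on_line l w -> peq v w].

Definition is_nucleus (F : fieldType) (Q : qform F) (N : vec3 F) : Prop :=
  N <> v0 F /\ forall l : vec3 F, tangent_line Q l -> on_line l N.

Definition aff (F : fieldType) (p : F * F) : vec3 F := (p.1, p.2, 1).

(* Om is a regular hyperoval of AG(2,F): Om is (the affine part of) the union
   of a non-degenerate conic and its nucleus, all of whose points are affine. *)
Definition regular_hyperoval_AG (F : finFieldType) (Om : {set F * F}) : Prop :=
  exists (Q : qform F) (n : F * F),
    [/\ qnondeg Q, is_nucleus Q (aff n) &
        forall v : vec3 F, v <> v0 F ->
          ((qeval Q v = 0 \/ peq (aff n) v) <->
           exists2 p, p \in Om & peq (aff p) v)].

Definition qnorm (K : fieldType) (q : nat) (x : K) : K := x ^+ q.+1.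

Definition odot (K : finFieldType) (q : nat) (U : {set K}) (a b : K) : K :=
  if qnorm q b \in U then a ^+ q * b else a * b.

(* points of the projective closure: affine points P(x,y), the point at
   infinity (m) of the parallel class of the lines [m,n], and the point at
   infinity (oo) of the parallel class of the lines [c]. *)
Inductive mpoint (K : Type) := MAff of K & K | MInfS of K | MInfV.
Inductive mline (K : Type) := LVert of K | LSlope of K & K | LInf.
Arguments MInfV {K}.
Arguments LInf {K}.

Definition minc (K : finFieldType) (q : nat) (U : {set K})
    (p : mpoint K) (l : mline K) : Prop :=
  match p, l with
  | MAff x _, LVert c => x = c
  | MAff x y, LSlope m n => y = odot q U m x + n
  | MAff _ _, LInf => False
  | MInfS m, LSlope m' _ => m = m'
  | MInfS _, LVert _ => False
  | MInfS _, LInf => True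
  | MInfV, LVert _ => True
  | MInfV, LSlope _ _ => False
  | MInfV, LInf => True
  end.

Definition marc (K : finFieldType) (q : nat) (U : {set K})
    (S : mpoint K -> Prop) : Prop :=
  forall (l : mline K) (p1 p2 p3 : mpoint K),
    S p1 -> S p2 -> S p3 ->
    minc q U p1 l -> minc q U p2 l -> minc q U p3 l ->
    p1 <> p2 -> p1 <> p3 -> p2 <> p3 -> False.

Definition affset (K : finFieldType) (Om : {set K * K}) (p : mpoint K) : Prop :=
  match p with MAff x y => (x, y) \in Om | _ => False end.

(* Main.v *)
Require Import Defs.
From HB Require Import structures.
From mathcomp Require Import all_boot all_order all_algebra all_field.
From mathcomp Require Import ring zify.
Set Implicit Arguments. Unset Strict Implicit. Unset Printing Implicit Defensive.
Import GRing.Theory.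
Local Open Scope ring_scope.

(* With its nucleus (x0, y0) as origin, a regular hyperoval of AG(2, q^2) is the
   nucleus together with the points where an anisotropic binary quadratic form
   takes a fixed nonzero value.  If it is an arc both of AG(2, q^2) and of M_U,
   then every affine line of either plane meets it in 0 or 2 points.  Hence, A
   being the set of its points (x, y) with ||x|| in U, in characteristic 2 the
   sum over A of phi (y - m x) equals the sum over A of phi (y - m^q x), for all
   phi and m.  For phi a power, comparing coefficients in m gives the vanishing
   of the sums over A of x^j y for many exponents j.  By interpolation in the
   norm and Fourier inversion, on each circle ||x|| = u with u in U the sum g(x)
   of the ordinates in column x is then an affine function of x.  But g(x) is 0
   or e (x - x0) for x <> x0, according to whether column x is empty, and
   g(x0) <> 0.  So x0 is not on the circle, and the columns over the circle are
   all empty or all nonempty.  As column x is nonempty iff the absolute trace of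
   delta / (x - x0) is 1, this trace is then constant on the circle; but
   after inversion it is a polynomial of degree q up to a power of the variable,
   and takes no value q + 1 times. *)

(** * Regular hyperovals in characteristic 2 *)

#[local] Arguments qeval : simpl never.

Section RegularHyperoval.
Variable K : finFieldType.
Hypothesis char2 : 2 \in [pchar K].

(** [ring] does not know that 2 is 0; exhibiting the discrepancy as [2%:R * e] turns an identity of
    characteristic 2 into one valid in every commutative ring. *)
Lemma char2_eq (x y e : K) : x = y + 2%:R * e -> x = y.
Proof. by rewrite pcharf0 // mul0r addr0. Qed.

Lemma char2_sqr_inj : injective (fun x : K => x ^+ 2).
Proof.
move=> x y /= /eqP; rewrite -subr_eq0 subr_sqr (GRing.subr_pchar2 char2) -expr2.
by rewrite expf_eq0 /= addr_eq0 (GRing.oppr_pchar2 char2) => /eqP.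
Qed.

Lemma char2_sqrt (x : K) : exists s, s ^+ 2 = x.
Proof. by exists (invF char2_sqr_inj x); rewrite (f_invF char2_sqr_inj). Qed.

Definition bform (a b d x y : K) : K := a * x ^+ 2 + b * y ^+ 2 + d * x * y.

Definition anisotropic (a b d : K) : Prop :=
  forall x y, bform a b d x y = 0 -> x = 0 /\ y = 0.

Lemma anisotropic_neq0 a b d :
  anisotropic a b d -> [/\ a != 0, b != 0 & d != 0].
Proof.
move=> an; have a0: a != 0.
  apply/eqP=> a0; have [] := an 1 0; first by rewrite /bform a0; ring.
  by move/eqP; rewrite oner_eq0.
split=> //; apply/eqP=> e0.
  have [] := an 0 1; first by rewrite /bform e0; ring.
  by move=> _ /eqP; rewrite oner_eq0.
(* With [d = 0] the form is the square of [s x + t y], which vanishes at [(t, s)]. *)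
have [[s sE] [t tE]] := (char2_sqrt a, char2_sqrt b).
have [] := an t s; first apply: (@char2_eq _ _ (a * b)).
  by rewrite /bform e0 sE tE; ring.
by move=> _ s0; case/eqP: a0; rewrite -sE s0 expr0n.
Qed.

(* In characteristic 2 the polar form of a conic has a radical, here
   (x0, y0, 1); expanding the form around it removes the cross terms. *)
Lemma qeval_radical (a b c d x0 y0 x y z : K) :
  qeval (a, b, c, d, d * y0, d * x0) (x, y, z)
  = z ^+ 2 * qeval (a, b, c, d, d * y0, d * x0) (x0, y0, 1)
    + bform a b d (x - x0 * z) (y - y0 * z).
Proof.
rewrite /qeval /bform; apply/esym.
apply: (@char2_eq _ _ (- a * x * x0 * z - b * y * y0 * z - d * y0 * x * z
  - d * x0 * y * z + (a * x0 ^+ 2 + b * y0 ^+ 2 + 2%:R * d * x0 * y0) * z ^+ 2)).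
ring.
Qed.

Lemma vec3_eq0 (x y z : K) : ((x, y, z) == v0 K) = [&& x == 0, y == 0 & z == 0].
Proof. by rewrite !xpair_eqE andbA. Qed.

(** On a line through the radical the form becomes [z ^+ 2 * g + t ^+ 2 * N]; square roots being
    unique, it has a single projective zero. Two such tangents meet only in the radical, which must
    therefore be the nucleus. *)
Lemma tangent_through_radical (a b c d x0 y0 : K) (l : vec3 K) (D : K * K) :
    let Q := (a, b, c, d, d * y0, d * x0) in
    anisotropic a b d -> qeval Q (x0, y0, 1) != 0 -> D != (0, 0) -> l <> v0 K ->
    (forall x y z, on_line l (x, y, z) <->
       exists t, x = x0 * z + t * D.1 /\ y = y0 * z + t * D.2) ->
  tangent_line Q l.
Proof.
case: D => D1 D2 /= an g0 D0 l0 onl; split=> //.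
set Q := (_, _, _, _, _, _) in g0 *; set g := qeval Q _ in g0.
pose N := bform a b d D1 D2.
have N0 : N != 0.
  by apply: contra_neq D0 => /an [-> ->].
have QE t z : qeval Q (x0 * z + t * D1, y0 * z + t * D2, z) = z ^+ 2 * g + t ^+ 2 * N.
  by rewrite qeval_radical -/g /N /bform; ring.
have [s sE] := char2_sqrt (g / N).
exists (x0 * 1 + s * D1, y0 * 1 + s * D2, 1); split.
- by move/eqP; rewrite vec3_eq0 oner_eq0 !andbF.
- rewrite QE sE divfK //; apply: (@char2_eq _ _ g); ring.
- by apply/onl; exists s.
case=> [[x y] z] w0 Qw /onl [t [xE yE]]; exists z; last first.
  rewrite /vscale /= mulr1; suff tE : t = z * s by rewrite xE yE tE; congr (_, _, _); ring.
  apply: char2_sqr_inj => /=; rewrite exprMn sE.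
  apply: (mulIf N0); rewrite mulrA divfK //.
  by move: Qw; rewrite xE yE QE => /eqP; rewrite addr_eq0 (GRing.oppr_pchar2 char2) => /eqP.
apply/eqP=> z0; case: w0; apply/eqP; rewrite vec3_eq0 z0.
move: Qw; rewrite xE yE z0 QE expr0n mul0r add0r => /eqP.
by rewrite mulf_eq0 (negPf N0) orbF expf_eq0 /= => /eqP->; rewrite !mulr0 !mul0r !addr0 eqxx.
Qed.

Definition conic_nucleus (a b d g x0 y0 : K) (p : K * K) : bool :=
  (p == (x0, y0)) || (bform a b d (p.1 - x0) (p.2 - y0) == g).

Lemma regular_hyperoval_normal_form (Om : {set K * K}) :
  regular_hyperoval_AG Om ->
  exists a b d g x0 y0,
    [/\ anisotropic a b d, g != 0 &
        forall p, (p \in Om) = conic_nucleus a b d g x0 y0 p].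
Proof.
case=> [[[[[[a b] c] d] e] f] [[n1 n2]]]; set Q := (_, _, _, _, _, _).
case=> [nd [_ nuc] OmP].
(* An isotropic vector would be a point of the conic at infinity. *)
have an : anisotropic a b d.
  move=> x y xy0; case: (eqVneq (x, y) (0, 0)) => [[-> ->] // | nz].
  have vn0 : (x, y, 0) <> v0 K.
    by move/eqP; rewrite vec3_eq0 eqxx andbT; apply/negP.
  have [| [p1 p2] _ [k k0]] := (OmP _ vn0).1.
    by left; apply: etrans xy0; rewrite /qeval /Q /bform; ring.
  by case=> _ _ /esym/eqP; rewrite mulr1 (negPf k0).
have [a0 b0 d0] := anisotropic_neq0 an.
pose x0 := f / d; pose y0 := e / d.
have QE : Q = (a, b, c, d, d * y0, d * x0).
  by rewrite /x0 /y0 !(mulrC d) !divfK.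
clearbody Q x0 y0.
have QR x y z : qeval Q (x, y, z) = z ^+ 2 * qeval Q (x0, y0, 1)
    + bform a b d (x - x0 * z) (y - y0 * z).
  by rewrite {1}QE qeval_radical -QE.
have R0 : (x0, y0, 1) <> v0 K by move/eqP; rewrite vec3_eq0 oner_eq0 !andbF.
have g0 : qeval Q (x0, y0, 1) != 0.
  apply/eqP => g0; apply: (nd _ R0 g0) => [[[x y] z]].
  by rewrite /qpolar g0 subr0 /vadd (QR x y z) QR g0 /bform /=; ring.
(* The vertical and the horizontal line through the radical are tangents, so both contain the
   nucleus [(n1, n2)]. *)
have nucx : x0 = n1.
  have : on_line (1, 0, - x0) (aff (n1, n2)).
    apply: nuc; rewrite QE; apply: (@tangent_through_radical _ _ _ _ _ _ _ (0, 1)) => //.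
    - by rewrite -QE.
    - by rewrite xpair_eqE oner_eq0 andbF.
    - by move/eqP; rewrite vec3_eq0 oner_eq0.
    move=> x y z; rewrite /on_line /=; split.
      move=> h; exists (y - y0 * z); split; last by ring.
      by rewrite mulr0 addr0; apply/eqP; rewrite -subr_eq0 -[X in _ == X]h; apply/eqP; ring.
    by case=> t [-> _]; ring.
  by rewrite /on_line /= => h; apply/eqP; rewrite eq_sym -subr_eq0 -[X in _ == X]h; apply/eqP; ring.
have nucy : y0 = n2.
  have : on_line (0, 1, - y0) (aff (n1, n2)).
    apply: nuc; rewrite QE; apply: (@tangent_through_radical _ _ _ _ _ _ _ (1, 0)) => //.
    - by rewrite -QE.
    - by rewrite xpair_eqE oner_eq0.
    - by move/eqP; rewrite vec3_eq0 oner_eq0 andbF.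
    move=> x y z; rewrite /on_line /=; split.
      move=> h; exists (x - x0 * z); split; first by ring.
      by rewrite mulr0 addr0; apply/eqP; rewrite -subr_eq0 -[X in _ == X]h; apply/eqP; ring.
    by case=> t [_ ->]; ring.
  by rewrite /on_line /= => h; apply/eqP; rewrite eq_sym -subr_eq0 -[X in _ == X]h; apply/eqP; ring.
exists a, b, d, (qeval Q (x0, y0, 1)), x0, y0; split=> // -[x y].
have v0' : aff (x, y) <> v0 K by move/eqP; rewrite vec3_eq0 oner_eq0 !andbF.
have affP (p : K * K) : peq (aff p) (aff (x, y)) -> p = (x, y).
  by case: p => p1 p2 [k _ []] /=; rewrite mulr1 => -> -> <-; rewrite !mul1r.
have aff_refl : peq (aff (x, y)) (aff (x, y)).
  by exists 1; rewrite ?oner_eq0 // /vscale /= !mul1r.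
have QxyE : (qeval Q (aff (x, y)) == 0) = (bform a b d (x - x0) (y - y0) == qeval Q (x0, y0, 1)).
  rewrite QR !mulr1 expr1n mul1r addrC.
  by rewrite addr_eq0 [- qeval _ _](GRing.oppr_pchar2 char2).
rewrite /conic_nucleus /= -QxyE nucx nucy.
apply/idP/orP.
  move=> pOm; have [|h|h] := (OmP _ v0').2.
  - by exists (x, y).
  - by right; apply/eqP.
  by left; rewrite (affP _ h).
move=> h; have [|p pOm /affP <- //] := (OmP _ v0').1.
by case: h => /eqP h; [right; rewrite h; rewrite h in aff_refl | left].
Qed.

End RegularHyperoval.

(** * Conic with its nucleus: size, arc property, column sums *)

Section ConicNucleus.
Variable K : finFieldType.
Hypothesis char2 : 2 \in [pchar K].

Lemma char2_artin_schreier_eq (x y : K) :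
  (x ^+ 2 + x == y ^+ 2 + y) = (x == y) || (x == y + 1).
Proof.
rewrite -subr_eq0 -(subr_eq0 x y) -(subr_eq0 x (y + 1)) -mulf_eq0; congr (_ == 0).
by apply: (char2_eq char2 (e := x + x * y - y ^+ 2 - y)); ring.
Qed.

Lemma addr_neq (x u : K) : u != 0 -> (x + u == x) = false.
Proof. by move=> /negPf u0; rewrite -subr_eq0 addrC addKr. Qed.

Variables (a b d g x0 y0 : K) (Om : {set K * K}).
Hypothesis an : anisotropic a b d.
Hypothesis g0 : g != 0.
Hypothesis OmE : forall p, (p \in Om) = conic_nucleus a b d g x0 y0 p.

Let b0 : b != 0. Proof. by case: (anisotropic_neq0 char2 an). Qed.
Let d0 : d != 0. Proof. by case: (anisotropic_neq0 char2 an). Qed.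

Lemma bform_neq0 x y : (x, y) != (0, 0) -> bform a b d x y != 0.
Proof. by apply: contra_neq => /an [-> ->]. Qed.

Lemma bformZ k x y : bform a b d (k * x) (k * y) = k ^+ 2 * bform a b d x y.
Proof. by rewrite /bform; ring. Qed.

(** Each of the |K| + 1 directions at the nucleus can be rescaled by a square root so that the form
    takes the value [g]. In the index type, [None] codes the nucleus, [Some None] the vertical
    direction and [Some (Some m)] the slope [m]. *)
Lemma card_conic_nucleus : (#|K| + 2 <= #|Om|)%N.
Proof.
pose sq := invF (@char2_sqr_inj K char2).
have sqE x : sq x ^+ 2 = x by apply: (f_invF (@char2_sqr_inj K char2)).
pose r D := sq (g / bform a b d D.1 D.2).
have rE D : D != (0, 0) -> bform a b d (r D * D.1) (r D * D.2) = g.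
  by case: D => D1 D2 D0; rewrite bformZ sqE divfK // bform_neq0.
have r0 D : D != (0, 0) -> r D != 0.
  move=> D0; apply: contra_neq g0 => e; rewrite -(rE D) // e !mul0r.
  by rewrite /bform; ring.
have D0 m : (1, m) != (0, 0) :> K * K by rewrite xpair_eqE oner_eq0.
have D1 : (0, 1) != (0, 0) :> K * K by rewrite xpair_eqE oner_eq0 andbF.
pose f (o : option (option K)) : K * K :=
  match o with
  | None => (x0, y0)
  | Some None => (x0, y0 + r (0, 1))
  | Some (Some m) => (x0 + r (1, m), y0 + r (1, m) * m)
  end.
have fOm o : f o \in Om.
  rewrite OmE /conic_nucleus; case: o => [[m|]|] /=; rewrite ?eqxx //; apply/orP; right.
    rewrite ![_ + _ - _]addrAC !subrr !add0r.
    by rewrite -[X in bform _ _ _ X _]mulr1 (rE (1, m)).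
  rewrite subrr addrAC subrr add0r -[X in bform _ _ _ _ X]mulr1.
  by rewrite -[X in bform _ _ _ X _](mulr0 (r (0, 1))) (rE (0, 1)).
have f_inj : injective f.
  move=> [[m|]|] [[m'|]|] //= [].
  - move=> /addrI e /addrI; rewrite e => /(mulfI (r0 _ (D0 _))) -> //.
  - by move/eqP; rewrite (addr_neq x0 (r0 _ (D0 _))).
  - by move/eqP; rewrite (addr_neq x0 (r0 _ (D0 _))).
  - by move/eqP; rewrite eq_sym (addr_neq x0 (r0 _ (D0 _))).
  - by move/eqP; rewrite (addr_neq y0 (r0 _ D1)).
  - by move/eqP; rewrite eq_sym (addr_neq x0 (r0 _ (D0 _))).
  - by move/eqP; rewrite eq_sym (addr_neq y0 (r0 _ D1)).
have <- : #|{: option (option K)}| = (#|K| + 2)%N by rewrite !card_option addn2.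
rewrite -(card_codom f_inj); apply: subset_leq_card.
by apply/subsetP=> _ /codomP [o ->].
Qed.

(** If one point is the nucleus, the two others have the same squared parameter as seen from it. If
    all lie on the conic, subtracting the equation at [P] and dividing by the parameter leaves a
    linear equation for it. *)
Lemma conic_nucleus_line (P D : K * K) (s t : K) :
    D != (0, 0) -> s != 0 -> t != 0 -> s != t ->
    P \in Om -> (P.1 + s * D.1, P.2 + s * D.2) \in Om ->
    (P.1 + t * D.1, P.2 + t * D.2) \in Om -> False.
Proof.
case: P D => P1 P2 [D1 D2] /= D0 s0 t0 st; have N0 := bform_neq0 D0.
rewrite !OmE /conic_nucleus /= !xpair_eqE.
pose N := bform a b d D1 D2; rewrite -/N in N0.
have sq_eq u v : u ^+ 2 * N = g -> v ^+ 2 * N = g -> u = v.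
  by move=> <- /(mulIf N0) /(char2_sqr_inj char2).
case/orP=> [/andP [/eqP-> /eqP->] | /eqP h1].
  rewrite ![_ + _ - _]addrAC !subrr !add0r !bformZ -/N => h2 h3.
  case/orP: h2 => [/andP [/eqP e1 /eqP e2]|/eqP h2].
    case/eqP: N0; rewrite /N; have -> : D1 = 0.
      by apply: (mulfI s0); rewrite mulr0; apply: (addrI x0); rewrite e1 addr0.
    have -> : D2 = 0.
      by apply: (mulfI s0); rewrite mulr0; apply: (addrI y0); rewrite e2 addr0.
    by rewrite /bform; ring.
  case/orP: h3 => [/andP [/eqP e1 /eqP e2]|/eqP h3].
    case/eqP: N0; rewrite /N; have -> : D1 = 0.
      by apply: (mulfI t0); rewrite mulr0; apply: (addrI x0); rewrite e1 addr0.
    have -> : D2 = 0.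
      by apply: (mulfI t0); rewrite mulr0; apply: (addrI y0); rewrite e2 addr0.
    by rewrite /bform; ring.
  by case/eqP: st; apply: sq_eq.
(* Here the nucleus is the point with parameter [u]: the others sit at [- u] and [v - u] from it,
   which forces [v = 2 u = 0]. *)
have split_off (u v : K) : u != 0 -> v != 0 -> u != v ->
    (P1 + u * D1 == x0) && (P2 + u * D2 == y0) ->
    (P1 + v * D1 == x0) && (P2 + v * D2 == y0)
      || (bform a b d (P1 + v * D1 - x0) (P2 + v * D2 - y0) == g) -> False.
  move=> u0 v0 uv /andP [/eqP e1 /eqP e2].
  have [f1 f2] : P1 = x0 - u * D1 /\ P2 = y0 - u * D2.
    by rewrite -e1 -e2 !addrK.
  have vuE : bform a b d (P1 + v * D1 - x0) (P2 + v * D2 - y0) = (v - u) ^+ 2 * N.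
    by rewrite -bformZ f1 f2; congr bform; ring.
  have uE : u ^+ 2 * N = g.
    by rewrite -h1 f1 f2 -sqrrN -bformZ; congr bform; ring.
  case/orP=> [/andP [/eqP e3 /eqP e4]|]; last first.
    rewrite vuE => /eqP /sq_eq /(_ uE) e.
    case/eqP: v0; apply/eqP; rewrite -(subrK u v) e (addrr_pchar2 char2) //.
  have := vuE; rewrite e3 e4 !subrr => /esym/eqP; rewrite /bform !expr0n !mulr0 !addr0.
  rewrite mulf_eq0 (negPf N0) orbF expf_eq0 /= subr_eq0 => /eqP vu.
  by rewrite vu eqxx in uv.
have main (u : K) : u != 0 -> bform a b d (P1 + u * D1 - x0) (P2 + u * D2 - y0) = g ->
    u * N = - (bform a b d (P1 + D1 - x0) (P2 + D2 - y0) - g - N).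
  move=> u0 h; apply: (mulfI u0); apply/eqP; rewrite -subr_eq0 -(subrr g).
  rewrite -[X in _ == X - _]h -h1; apply/eqP; rewrite /N /bform; ring.
move=> h2 h3; case/orP: (h2) => [|/eqP h2']; first by move/(split_off s t s0 t0 st); apply.
case/orP: (h3) => [|/eqP h3'].
  by rewrite eq_sym in st; move/(split_off t s t0 s0 st); apply.
by case/eqP: st; apply: (mulIf N0); rewrite (main s) // (main t).
Qed.

(** With [set0] as exceptional set, [odot] is the field product, so this is the arc property in the
    closure of the classical affine plane. *)
Lemma conic_nucleus_arc q : marc q set0 (affset Om).
Proof.
move=> l [x1 y1|//|//] [x2 y2|//|//] [x3 y3|//|//] /= o1 o2 o3.
have neqE (x y x' y' : K) : MAff x y <> MAff x' y' -> (x, y) != (x', y').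
  by move=> h; apply/eqP=> -[e e']; case: h; rewrite e e'.
case: l => [c|m n|//] /=.
  move=> e1 e2 e3; subst x1 x2 x3.
  move=> /neqE; rewrite xpair_eqE eqxx /= => n12.
  move=> /neqE; rewrite xpair_eqE eqxx /= => n13.
  move=> /neqE; rewrite xpair_eqE eqxx /= => n23.
  apply: (@conic_nucleus_line (c, y1) (0, 1) (y2 - y1) (y3 - y1)) => //=.
  - by rewrite xpair_eqE oner_eq0 andbF.
  - by rewrite subr_eq0 eq_sym.
  - by rewrite subr_eq0 eq_sym.
  - by apply: contra_neq n23 => /addIr.
  - by rewrite !mulr0 mulr1 addr0 addrC subrK.
  - by rewrite !mulr0 mulr1 addr0 addrC subrK.
rewrite /odot !inE => e1 e2 e3; subst y1 y2 y3.
have neqx x x' : MAff x (m * x + n) <> MAff x' (m * x' + n) -> x != x'.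
  by move=> h; apply/eqP=> e; case: h; rewrite e.
move=> /neqx n12 /neqx n13 /neqx n23.
apply: (@conic_nucleus_line (x1, m * x1 + n) (1, m) (x2 - x1) (x3 - x1)) => //=.
- by rewrite xpair_eqE oner_eq0.
- by rewrite subr_eq0 eq_sym.
- by rewrite subr_eq0 eq_sym.
- by apply: contra_neq n23 => /addIr.
- by rewrite mulr1; have -> : m * x1 + n + (x2 - x1) * m = m * x2 + n by [ring]; rewrite addrC subrK.
- by rewrite mulr1; have -> : m * x1 + n + (x3 - x1) * m = m * x3 + n by [ring]; rewrite addrC subrK.
Qed.

(** This column holds only [y0] and [y0 + s] with [s ^+ 2 = g / b], so the sum is [s]. *)
Lemma conic_nucleus_column_nucleus : \sum_(y | (x0, y) \in Om) y != 0.
Proof.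
have [s sE] := char2_sqrt char2 (g / b).
have s0 : s != 0.
  by apply: contra_neq g0 => s0; rewrite -(divfK b0 g) -sE s0 expr0n mul0r.
rewrite (bigD1 y0) /=; last by rewrite OmE /conic_nucleus eqxx.
rewrite (big_pred1 (y0 + s)) => [|y].
  by rewrite addrA (addrr_pchar2 char2) add0r.
rewrite OmE /conic_nucleus xpair_eqE eqxx /= subrr.
have [->|ny] /= := eqVneq y y0.
  by rewrite eq_sym addr_neq.
rewrite andbT (addrC y0 s) -(subr_eq y s y0); apply/eqP/eqP => [h|->].
  apply: (char2_sqr_inj char2); rewrite /= sE -h; apply: (mulIf b0).
  by rewrite divfK // /bform; ring.
by rewrite /bform sE; field.
Qed.

(* Putting y - y0 = (d (x - x0) / b) (z - tau) turns the equation of the conic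
   in the column of x into z ^+ 2 + z = a b / d^2 + tau. *)
Lemma conic_nucleus_column (s x : K) : s ^+ 2 = b * g -> x != x0 ->
  \sum_(y | (x, y) \in Om) y =
    if [exists z, z ^+ 2 + z == a * b / d ^+ 2 + s / d / (x - x0)]
    then d / b * (x - x0) else 0.
Proof.
move=> sE nx; have w0 : x - x0 != 0 by rewrite subr_eq0.
set w := x - x0 in w0 *; set tau := s / d / w.
have gE : g = s ^+ 2 / b by rewrite sE mulrC mulKf.
pose Z y := b * (y - y0) / (d * w) + tau.
have colE y : ((x, y) \in Om) = (Z y ^+ 2 + Z y == a * b / d ^+ 2 + tau).
  rewrite OmE /conic_nucleus xpair_eqE (negPf nx) /= -/w.
  rewrite -subr_eq0 -[RHS]subr_eq0.
  rewrite -[RHS](mulIr_eq0 _ (mulIf (_ : (d * w) ^+ 2 / b != 0))); last first.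
    by rewrite mulf_neq0 ?invr_eq0 ?expf_neq0 ?mulf_neq0.
  congr (_ == 0); apply: (char2_eq char2 (e := a * w ^+ 2 - g - s * (y - y0))).
  by rewrite gE /Z /tau /bform; field; rewrite w0 d0 b0.
case: ifP => [/existsP [z /eqP zE]|/negbT/existsPn nz]; last first.
  by rewrite big_pred0 // => y; rewrite colE (negPf (nz _)).
pose y1 := y0 + d * w / b * (z - tau).
have ZI y u : (Z y == u) = (y == y0 + d * w / b * (u - tau)).
  apply/eqP/eqP => [<-|->]; rewrite /Z; field; by rewrite ?w0 ?d0 ?b0.
(* The two roots [z] and [z + 1] give ordinates differing by [d / b * w], which is then their
   sum. *)
have colE' y : ((x, y) \in Om) = (y == y1) || (y == y1 + d / b * w).
  rewrite colE -zE char2_artin_schreier_eq !ZI; congr (_ || (_ == _)).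
  by rewrite /y1; field.
rewrite (bigD1 y1) /=; last by rewrite colE' eqxx.
rewrite (big_pred1 (y1 + d / b * w)) => [|y].
  by rewrite addrA (addrr_pchar2 char2) add0r.
rewrite colE'; have [->|] := eqVneq y y1; last by rewrite andbT.
by rewrite andbF /= eq_sym addr_neq // mulf_neq0 // mulf_neq0 // invr_eq0.
Qed.

End ConicNucleus.

(** * Arcs of the plane M_U *)

Section MoultonPlane.
Variable K : finFieldType.
Hypothesis char2 : 2 \in [pchar K].
Variable q : nat.
Hypothesis q_pow : [pchar K].-nat q.
Hypothesis cardK : #|K| = (q ^ 2)%N.

Lemma expf_qq (x : K) : x ^+ q ^+ q = x.
Proof. by rewrite -exprM mulnn -cardK expf_card. Qed.

Lemma q_gt1 : (1 < q)%N.
Proof.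
have := finNzRing_gt1 K; rewrite cardK -{1}(exp1n 2) ltn_exp2r //.
Qed.

Lemma qnorm_frob (x : K) : qnorm q (x ^+ q) = qnorm q x.
Proof. by rewrite /qnorm exprS expf_qq exprSr. Qed.

Lemma qnormM (x y : K) : qnorm q (x * y) = qnorm q x * qnorm q y.
Proof. exact: exprMn. Qed.

Variable U : {set K}.

Lemma qnorm_odot (a b : K) : qnorm q (odot q U a b) = qnorm q (a * b).
Proof. by rewrite /odot; case: ifP => _ //; rewrite !qnormM qnorm_frob. Qed.

Lemma odotB (a a' b : K) : odot q U (a - a') b = odot q U a b - odot q U a' b.
Proof.
rewrite /odot; case: ifP => _; rewrite -mulrBl // (GRing.subr_pchar2 char2).
by rewrite exprDn_pchar // (GRing.subr_pchar2 char2).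
Qed.

(** Comparing norms first shows that [b] and [c] have equal norm, so both products use the same
    branch of [odot]. *)
Lemma odot_inj (a b c : K) : a != 0 -> odot q U a b = odot q U a c -> b = c.
Proof.
move=> a0 e; have : qnorm q b = qnorm q c.
  have := congr1 (qnorm q) e; rewrite !qnorm_odot !qnormM.
  by apply: mulfI; rewrite expf_neq0.
move=> n; move: e; rewrite /odot n; case: ifP => _; apply: mulfI => //.
by rewrite expf_neq0.
Qed.

(** On a finite field injectivity gives surjectivity: points in different columns are joined by
    exactly one line with a slope. *)
Lemma slope_inj (x y : K) :
  x != y -> injective (fun m => odot q U m x - odot q U m y).
Proof.
move=> xy m m' /= e; apply/eqP; rewrite -subr_eq0; apply: contraNT xy => mm'.
apply/eqP; apply: (odot_inj mm'); rewrite !odotB; apply/eqP.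
rewrite -subr_eq0; move/eqP: e; rewrite -subr_eq0 => /eqP <-.
by apply/eqP; ring.
Qed.

Variable Om : {set K * K}.
Hypothesis arc : marc q U (affset Om).
Hypothesis card_Om : (#|K| + 2 <= #|Om|)%N.

Definition line_trace (m n : K) : {set K * K} :=
  [set p in Om | p.2 - odot q U m p.1 == n].

(* An arc with |K| + 2 points: through a point P, the |K| + 1 other points lie
   on pairwise different lines, hence use up all |K| + 1 lines on P. *)
Lemma card_line_trace (m n : K) :
  #|line_trace m n| = 0%N \/ #|line_trace m n| = 2%N.
Proof.
have aff_neq (p r : K * K) : p != r -> MAff p.1 p.2 <> MAff r.1 r.2.
  by case: p r => [p1 p2] [r1 r2] /eqP nn [e e']; apply: nn; rewrite e e'.
have affE (p : K * K) : p \in Om -> affset Om (MAff p.1 p.2) by case: p.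
have onl (p : K * K) m' n' : p.2 - odot q U m' p.1 = n' ->
    minc q U (MAff p.1 p.2) (LSlope m' n').
  by move=> <- /=; rewrite addrC subrK.
case: (ltngtP #|line_trace m n| 2%N) => [|/card_gt2P [p1 [p2 [p3]]]|->]; last by right.
  rewrite ltnS leq_eqVlt ltnS leqn0 => /orP [/cards1P [P /setP FP]|/eqP]; last by left.
  have := FP P; rewrite !inE eqxx => /andP [POm /eqP Pn].
  (* The line joining [P] to [p]: [None] if vertical, otherwise [Some] of its slope. *)
  pose sl p := if p.1 == P.1 then None
    else [pick m' | odot q U m' P.1 - odot q U m' p.1 == P.2 - p.2].
  have slP p : p.1 != P.1 ->
      exists2 m', sl p = Some m' & p.2 - odot q U m' p.1 = P.2 - odot q U m' P.1.
    move=> np; rewrite /sl (negPf np); case: pickP => [m' /eqP m'E|].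
      exists m' => //; apply/eqP; rewrite -subr_eq0; apply/eqP.
      by rewrite -[RHS](subrr (P.2 - p.2)) -{1}m'E; ring.
    rewrite eq_sym in np; have inj := slope_inj np.
    by move/(_ (invF inj (P.2 - p.2))); rewrite (f_invF inj) eqxx.
  have sl_inj : {in Om :\ P &, injective sl}.
    move=> p r; rewrite !inE => /andP [pP pOm] /andP [rP rOm] e.
    apply/eqP/negP => /negP pr.
    have three l : minc q U (MAff P.1 P.2) l -> minc q U (MAff p.1 p.2) l ->
        minc q U (MAff r.1 r.2) l -> False.
      move=> lP lp lr; apply: (arc (affE _ POm) (affE _ pOm) (affE _ rOm) lP lp lr);
        by apply: aff_neq; rewrite // eq_sym.
    have [ep|np] := eqVneq p.1 P.1; have [er|nr] := eqVneq r.1 P.1.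
    - exact: (three (LVert P.1)).
    - by have [m' m'E _] := slP _ nr; move: e; rewrite m'E /sl ep eqxx.
    - by have [m' m'E _] := slP _ np; move: e; rewrite m'E /sl er eqxx.
    have [mp pE lp] := slP _ np; have [mr rE lr] := slP _ nr.
    move: e; rewrite pE rE => -[e]; subst mr.
    exact: (three _ (onl _ _ _ erefl) (onl _ _ _ lp) (onl _ _ _ lr)).
  (* If the line of slope [m] meets [Om] in [P] alone, the injective [sl] misses [Some m], leaving
     |K| values for at least |K| + 1 points. *)
  have : sl @: (Om :\ P) \subset [set~ Some m].
    apply/subsetP => _ /imsetP [p /setD1P [pP pOm] ->]; rewrite !inE.
    apply/eqP => pm; have [e|np] := eqVneq p.1 P.1; first by rewrite /sl e eqxx in pm.
    have [m' m'E lp] := slP _ np; move: m'E; rewrite pm => -[e]; subst m'.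
    by have := FP p; rewrite !inE pOm lp Pn eqxx (negPf pP).
  move/subset_leq_card; rewrite card_in_imset // cardsC1 card_option /=.
  by move: card_Om; rewrite (cardsD1 P Om) POm add1n addn2 ltnS => h1 /(leq_trans h1); rewrite ltnn.
case=> -[]; rewrite !inE => /andP [o1 /eqP l1] /andP [o2 /eqP l2] /andP [o3 /eqP l3].
case=> n12 n23 n31.
by case: (arc (affE _ o1) (affE _ o2) (affE _ o3) (onl _ _ _ l1) (onl _ _ _ l2)
  (onl _ _ _ l3)); apply: aff_neq => //; rewrite eq_sym.
Qed.

(** Grouped by parallel lines of slope [m], each value of [phi] occurs 0 or 2 times. *)
Lemma sum_lines_eq0 (phi : K -> K) (m : K) :
  \sum_(p in Om) phi (p.2 - odot q U m p.1) = 0.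
Proof.
rewrite (partition_big (fun p => p.2 - odot q U m p.1) predT) //=.
apply: big1 => n _; rewrite (eq_bigr (fun _ => phi n)); last by move=> p /andP [_ /eqP ->].
rewrite sumr_const; have -> : #|[pred p in Om | p.2 - odot q U m p.1 == n]| = #|line_trace m n|.
  by apply: eq_card => p; rewrite !inE.
by case: (card_line_trace m n) => ->; rewrite ?mulr0n // mulr2n (addrr_pchar2 char2).
Qed.

End MoultonPlane.

(** * Moments of the points with norm in U *)

Section Moments.
Variable K : finFieldType.
Hypothesis char2 : 2 \in [pchar K].
Variable q : nat.
Hypothesis q_pow : [pchar K].-nat q.
Hypothesis q_even : ~~ odd q.
Hypothesis cardK : #|K| = (q ^ 2)%N.

Lemma digits_inj (e f e' f' : nat) : (e < q)%N -> (e' < q)%N ->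
  (e + q * f = e' + q * f')%N -> e = e' /\ f = f'.
Proof.
move=> eq e'q h; have ee : e = e'.
  have := congr1 (modn^~ q) h.
  by rewrite !(mulnC q) ![(_ + _ * q)%N]addnC !modnMDl !modn_small.
by split=> //; move: h; rewrite ee => /addnI /eqP; rewrite eqn_pmul2l; [move/eqP | lia].
Qed.

(** The exponents [e + q * f] are distinct and below |K|, and a polynomial of degree below |K| that
    vanishes on [K] is zero. *)
Lemma expr_digits_eq0 (D : nat -> nat -> K) :
  (forall m : K, \sum_(e < q) \sum_(f < q) D e f * m ^+ (e + q * f) = 0) ->
  forall e f, (e < q)%N -> (f < q)%N -> D e f = 0.
Proof.
move=> D0; pose P : {poly K} := \sum_(e < q) \sum_(f < q) D e f *: 'X^(e + q * f).
have coefP j : P`_j = \sum_(e < q) \sum_(f < q) D e f * (j == e + q * f)%N%:R.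
  rewrite coef_sum; apply: eq_bigr => e _; rewrite coef_sum.
  by apply: eq_bigr => f _; rewrite coefZ coefXn.
have szP : (size P <= q ^ 2)%N.
  apply/leq_sizeP => j hj; rewrite coefP big1 // => e _; rewrite big1 // => f _.
  case: eqP => [jE|_]; last by rewrite mulr0.
  by have := ltn_ord e; have := ltn_ord f; move: hj; rewrite jE; nia.
have P0 : P = 0.
  apply/eqP; apply: contraLR szP => nP; rewrite -ltnNge -cardK cardE.
  apply: max_poly_roots => //; last exact: enum_uniq.
  apply/allP => m _; rewrite /root -[X in _ == X](D0 m) horner_sum; apply/eqP.
  apply: eq_bigr => e _; rewrite horner_sum; apply: eq_bigr => f _.
  by rewrite hornerZ hornerXn.
move=> e f he hf; have := coefP (e + q * f)%N; rewrite P0 coef0.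
rewrite (bigD1 (Ordinal he)) //= (bigD1 (Ordinal hf)) //= eqxx mulr1.
rewrite big1 ?addr0 => [|f' /eqP nf]; last first.
  case: eqP => [h|_]; last by rewrite mulr0.
  by case: nf; apply/val_inj; case: (digits_inj he he h).
rewrite big1 ?addr0 => [// |e' /eqP ne].
rewrite big1 // => f' _; case: eqP => [h|_]; last by rewrite mulr0.
by case: ne; apply/val_inj; case: (digits_inj he (ltn_ord e') h).
Qed.

Lemma exprDn_widen (x y : K) (k : nat) : (k < q)%N ->
  (x + y) ^+ k = \sum_(e < q) 'C(k, e)%:R * x ^+ (k - e) * y ^+ e.
Proof.
move=> kq; rewrite exprDn.
rewrite (big_ord_widen q (fun e => x ^+ (k - e) * y ^+ e *+ 'C(k, e))) //.
rewrite big_mkcond; apply: eq_bigr => e _; rewrite ltnS.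
case: leqP => h; last by rewrite bin_small // !mul0r.
by rewrite -mulrA mulr_natl.
Qed.

Variable A : {set K * K}.
Hypothesis sum_frob : forall (phi : K -> K) (m : K),
  \sum_(p in A) phi (p.2 + m * p.1) = \sum_(p in A) phi (p.2 + m ^+ q * p.1).

(* Compares the coefficients of m ^ (a + q b) in the sums of
   (y + m x) ^ (a + 1 + q b) and (y + m ^ q x) ^ (a + 1 + q b), reduced modulo
   m ^ (q ^ 2) = m: the digits of the exponents of m are interchanged. *)
Lemma moment_eq0 (a b : nat) :
    ~~ odd a -> (a < q)%N -> (b < q)%N -> a != b -> b != a.+1 ->
  \sum_(p in A) p.1 ^+ (a + q * b) * p.2 = 0.
Proof.
move=> a_even aq bq ab ba.
have kq : (a.+1 < q)%N by move: q_even; lia.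
pose c (e f : nat) : K := 'C(a.+1, e)%:R * 'C(b, f)%:R *
  \sum_(p in A) p.1 ^+ (e + q * f) * p.2 ^+ (a.+1 - e + q * (b - f)).
have cE m : \sum_(p in A) (p.2 + m * p.1) ^+ (a.+1 + q * b)
    = \sum_(e < q) \sum_(f < q) c e f * m ^+ (e + q * f).
  under [RHS]eq_bigr do under eq_bigr do rewrite /c mulr_sumr mulr_suml.
  under [RHS]eq_bigr do rewrite exchange_big.
  rewrite exchange_big; apply: eq_bigr => -[x y] _ /=.
  rewrite exprD exprM (exprDn_pchar _ _ q_pow) (exprDn_widen _ _ kq) (exprDn_widen _ _ bq).
  rewrite mulr_suml; apply: eq_bigr => e _; rewrite mulr_sumr; apply: eq_bigr => f _.
  by rewrite !exprD !exprM !exprMn; ring.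
have csym e f : (e < q)%N -> (f < q)%N -> c e f = c f e.
  move=> eq fq; apply/eqP; rewrite -subr_eq0; apply/eqP.
  apply: (@expr_digits_eq0 (fun e f => c e f - c f e)) => // m.
  under eq_bigr do under eq_bigr do rewrite mulrBl.
  under eq_bigr do rewrite sumrB.
  rewrite sumrB -cE (sum_frob (fun z => z ^+ (a.+1 + q * b))) cE; apply/eqP; rewrite subr_eq0; apply/eqP.
  rewrite exchange_big; apply: eq_bigr => e' _; apply: eq_bigr => f' _.
  by rewrite !exprD !exprM (expf_qq cardK) mulrC [m ^+ e' * _]mulrC mulrC.
(* Here [c a b] is a + 1 times the wanted moment, and a + 1 is odd; [c b a] is 0, since
   ['C(a.+1, b)] or ['C(b, a)] vanishes unless b is a or a + 1. *)
have := csym a b aq bq; rewrite {1}/c binSn binn mulr1 !subnn muln0 addn0 subSnn.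
have -> : a.+1%:R = 1 :> K.
  by rewrite -(odd_double_half a) (negPf a_even) -addn1 natrD -muln2 natrM (pcharf0 char2) mulr0 add0r.
under eq_bigr do rewrite expr1.
rewrite mul1r => ->; rewrite /c.
case: (ltngtP a b) => [h|h|h]; last by rewrite h eqxx in ab.
  by rewrite bin_small ?mul0r //; move: ba; lia.
by rewrite (bin_small h) mulr0 mul0r.
Qed.

(** The exponent (q + 1) n + i has base-q digits n + i and n, or n + i - q and n + 1 after a carry.
    The parity condition makes the low digit even. *)
Lemma norm_moment_eq0 (i n : nat) :
    (0 < i < q)%N -> (n <= q - 2)%N -> odd n = odd i ->
  \sum_(p in A) qnorm q p.1 ^+ n * (p.1 ^+ i * p.2) = 0.
Proof.
move=> iq nq par; have q1 := q_gt1 cardK.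
have [a [b [ae aq bq [ab ba] E]]] : exists a b, [/\ ~~ odd a, (a < q)%N, (b < q)%N,
    a != b /\ b != a.+1 & (q.+1 * n + i = a + q * b)%N].
  have [h|h] := ltnP (n + i) q.
    by exists (n + i)%N, n; split; move: par; lia.
  by exists (n + i - q)%N, n.+1; split; move: par q_even; lia.
rewrite -[RHS](moment_eq0 ae aq bq ab ba); apply: eq_bigr => p _.
by rewrite mulrA /qnorm -exprM -exprD E.
Qed.

Variable U : {set K}.
Hypothesis U0 : forall u, u \in U -> u != 0.
Hypothesis cardU : (4 * #|U| + 4 < q)%N.
Hypothesis A_U : forall p, p \in A -> qnorm q p.1 \in U.

(* Lagrange interpolation at the squares of the norms: squares make every
   exponent of the norm have the parity that norm_moment_eq0 requires. *)
Lemma circle_moment_eq0 (u : K) (i : nat) : u \in U -> (0 < i < q)%N ->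
  \sum_(p in A | qnorm q p.1 == u) p.1 ^+ i * p.2 = 0.
Proof.
move=> uU iq; pose P : {poly K} := \prod_(v in U :\ u) ('X - (v ^+ 2)%:P).
have szP : size P = #|U|.
  by rewrite /P -big_enum size_prod_XsubC -cardE (cardsD1 u U) uU.
have Pu : P.[u ^+ 2] != 0.
  rewrite horner_prod; apply/prodf_neq0 => v /setD1P [vu _].
  rewrite hornerXsubC subr_eq0; apply: contra_neq vu => h.
  by rewrite (char2_sqr_inj char2 h).
have Pv v : v \in U -> v != u -> P.[v ^+ 2] = 0.
  move=> vU vu; rewrite horner_prod (bigD1 v) ?inE ?vu //=.
  by rewrite hornerXsubC subrr mul0r.
(* The factor [qnorm q p.1 ^+ odd i] gives every exponent [2 * j + odd i] the parity of [i]; as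
   [size P] is |U|, these exponents stay at most [q - 2]. *)
have : \sum_(p in A) P.[qnorm q p.1 ^+ 2] * (qnorm q p.1 ^+ odd i * (p.1 ^+ i * p.2)) = 0.
  under eq_bigr do rewrite horner_coef mulr_suml.
  rewrite exchange_big big1 // => j _.
  transitivity (P`_j * \sum_(p in A) qnorm q p.1 ^+ (2 * j + odd i) * (p.1 ^+ i * p.2)).
    by rewrite mulr_sumr; apply: eq_bigr => p _; rewrite exprD exprM; ring.
  rewrite norm_moment_eq0 ?mulr0 //; last by rewrite oddD oddM /= oddb.
  by have := leq_trans (ltn_ord j) (eq_leq szP); move: cardU; case: (odd i); lia.
rewrite (bigID (fun p => qnorm q p.1 == u)) /= [X in _ + X]big1 ?addr0; last first.
  by move=> p /andP [pA pu]; rewrite Pv ?mul0r // A_U.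
under eq_bigr => p /andP [_ /eqP ->] do rewrite mulrA.
rewrite -mulr_sumr => /eqP; rewrite mulf_eq0 => /orP [|/eqP //].
by rewrite mulf_eq0 (negPf Pu) /= expf_eq0 (negPf (U0 uU)) andbF.
Qed.

Lemma geometric_circle (r : K) : qnorm q r = 1 ->
  \sum_(i < q.+1) r ^+ i = (r == 1)%:R.
Proof.
move=> r1; have [->|nr] := eqVneq r 1.
  under eq_bigr do rewrite expr1n.
  rewrite sumr_const card_ord -(odd_double_half q) (negPf q_even) add0n.
  by rewrite -addn1 mulrnDr -muln2 mulnC mulrnA (pcharf0 char2) mul0rn add0r.
apply: (mulfI (_ : r - 1 != 0)); first by rewrite subr_eq0.
by rewrite -subrX1 mulr0 -/(qnorm q r) r1 subrr.
Qed.

(* Fourier inversion on the circle of norm u: only the frequencies 0 and q,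
   i.e. the characters 1 and x, survive. *)
Lemma column_sum_affine (u : K) : u \in U ->
  exists alpha beta : K, forall x, qnorm q x = u ->
    \sum_(y | (x, y) \in A) y = alpha + beta * x.
Proof.
move=> uU; have q1 := q_gt1 cardK.
pose G i := \sum_(p in A | qnorm q p.1 == u) p.1 ^+ i * p.2.
exists (G 0%N), (G q / u) => x xu.
have u0 := U0 uU; have x0 : x != 0.
  by apply: contra_neq u0 => x0; rewrite -xu x0 /qnorm expr0n.
(* The indicator of [p.1 = x] on the circle is the geometric sum of the powers of [p.1 / x]. *)
transitivity (\sum_(i < q.+1) x ^- i * G i).
  under [RHS]eq_bigr do rewrite /G mulr_sumr.
  rewrite exchange_big /=.
  transitivity (\sum_(p in A | qnorm q p.1 == u) (p.1 == x)%:R * p.2).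
    rewrite (bigID (fun p => p.1 == x)) /= [X in _ = _ + X]big1 ?addr0; last first.
      by move=> p /andP [_ /negPf ->]; rewrite mul0r.
    rewrite (reindex_onto (fun y => (x, y)) snd) /=; last first.
      by move=> [x' y] /= /andP [_ /eqP ->].
    by apply: eq_big => [y|y _]; rewrite ?eqxx ?mul1r // xu !eqxx !andbT.
  apply: eq_bigr => p /andP [_ /eqP pu].
  have -> : (p.1 == x) = (p.1 / x == 1).
    by rewrite -[RHS](inj_eq (mulIf x0)) divfK // mul1r.
  rewrite -geometric_circle; last by rewrite /qnorm exprMn exprVn -!/(qnorm q _) pu xu divff.
  by rewrite mulr_suml; apply: eq_bigr => i _; rewrite exprMn exprVn; ring.
rewrite big_ord_recr (bigD1 (Ordinal (ltnW q1))) //= expr0 invr1 mul1r.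
rewrite big1 ?addr0 => [|i i0]; last first.
  by rewrite /G circle_moment_eq0 ?mulr0 // ltn_ord lt0n andbT.
(* The frequency [q] yields the linear term because [x ^- q = x / u]. *)
congr (_ + _); rewrite -xu /qnorm exprSr; field.
by rewrite x0 expf_neq0.
Qed.

End Moments.

(** * Norm circles and the absolute trace *)

Lemma card_roots_lt (F : finFieldType) (P : {poly F}) (S : {set F}) :
  P != 0 -> (forall x, x \in S -> P.[x] = 0) -> (#|S| < size P)%N.
Proof.
move=> P0 PS; rewrite cardE; apply: max_poly_roots => //; last exact: enum_uniq.
by apply/allP => x; rewrite mem_enum => /PS e; apply/eqP.
Qed.

(** The image of [z ^+ 2 + z] is a subgroup of index at most 2, since the fibres have at most two
    elements; it and its translate by [x] thus fill the field. *)
Lemma char2_artin_schreier_index2 (F : finFieldType) (x y : F) : 2 \in [pchar F] ->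
    (forall z, z ^+ 2 + z <> x) -> (forall z, z ^+ 2 + z <> y) ->
  exists z, z ^+ 2 + z = x + y.
Proof.
move=> char2 nx ny; pose f (z : F) := z ^+ 2 + z.
have fD z z' : f (z + z') = f z + f z'.
  by apply: (char2_eq char2 (e := z * z')); rewrite /f; ring.
pose S := [set f z | z in [set: F]].
have inS z : f z \in S by apply/imsetP; exists z; rewrite ?inE.
have cardS : (#|F| <= #|S| * 2)%N.
  rewrite -[#|F|]sum1_card (partition_big f (mem S)) => [|z _]; last exact: inS.
  rewrite -sum_nat_const; apply: leq_sum => s /imsetP [z0 _ ->].
  rewrite sum1_card.
  apply: (@leq_trans #|[set z0; z0 + 1]|); last by rewrite cards2; case: eqP.
  apply: subset_leq_card; apply/subsetP => z fz.
  have {fz} : f z == f z0 by exact: fz.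
  by rewrite /f char2_artin_schreier_eq // !inE.
pose T := [set x + s | s in S].
have dST : [disjoint S & T].
  apply/pred0P => s /=; apply/negP => /andP [/imsetP [z _ ->] /imsetP [s' /imsetP [z' _ ->] e]].
  by apply: (nx (z - z')); rewrite -/(f _) (GRing.subr_pchar2 char2) fD e addrK_pchar2.
have cardT : #|T| = #|S| by rewrite card_imset //; apply: addrI.
have : y \in S :|: T.
  have -> : S :|: T = setT; last by rewrite inE.
  by apply/eqP; rewrite eqEcard subsetT cardsT cardsU (disjoint_setI0 dST) cards0 subn0 cardT addnn -muln2.
rewrite inE => /orP [/imsetP [z _ e]|/imsetP [s /imsetP [z _ ->] ->]]; first by case: (ny z).
by exists z; rewrite addrA (addrr_pchar2 char2) add0r.
Qed.

Section Circles.
Variables (K : finFieldType) (q : nat).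
Hypothesis cardK : #|K| = (q ^ 2)%N.

Definition circle (u : K) : {set K} := [set x | qnorm q x == u].

(** The q^2 - 1 nonzero elements lie on at most q - 1 circles of at most q + 1 points each, so every
    circle is full. *)
Lemma card_circle (u : K) : u != 0 -> u ^+ q = u -> (q < #|circle u|)%N.
Proof.
move=> u0 uq; have q1 : (1 < q)%N := q_gt1 cardK.
pose Fs := [set v : K | (v != 0) && (v ^+ q == v)].
have cardFs : (#|Fs| < q)%N.
  have szP : size ('X^q - 'X : {poly K}) = q.+1.
    by rewrite size_polyDl size_polyXn // size_polyN size_polyX.
  have -> : #|Fs| = #|0 |: Fs|.-1 by rewrite cardsU1 inE eqxx.
  rewrite -ltnS prednK; last by rewrite (cardsD1 0) !inE eqxx.
  rewrite -szP; apply: card_roots_lt; first by rewrite -size_poly_eq0 szP.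
  move=> v; rewrite !inE hornerD hornerN hornerXn hornerX => /orP [/eqP->|/andP [_ /eqP->]].
    by rewrite expr0n subr0; case: (q) q1.
  by rewrite subrr.
have circle_le v : (#|circle v| <= q.+1)%N.
  have szP : size ('X^(q.+1) - v%:P : {poly K}) = q.+2 by rewrite size_XnsubC.
  rewrite -ltnS -szP; apply: card_roots_lt; first by rewrite -size_poly_eq0 szP.
  by move=> x; rewrite inE hornerD hornerN hornerXn hornerC => /eqP; rewrite /qnorm => ->; rewrite subrr.
have uFs : u \in Fs by rewrite inE u0 uq eqxx.
have normFs x : x != 0 -> qnorm q x \in Fs.
  move=> x0; rewrite inE expf_neq0 //=; apply/eqP.
  by rewrite /qnorm -exprM mulnC exprM; exact: (qnorm_frob cardK).
have : (#|[set~ (0%R : K)]| <= #|circle u| + (q - 2) * q.+1)%N.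
  rewrite -sum1_card (partition_big (@qnorm K q) (mem Fs)) => [|x]; last first.
    by rewrite !inE => /normFs; rewrite inE.
  rewrite (bigD1 u) //=; apply: leq_add.
    by rewrite sum1_card; apply: subset_leq_card; apply/subsetP => x; rewrite !inE => /andP [].
  apply: (@leq_trans (\sum_(v in Fs :\ u) q.+1)).
    rewrite [X in (_ <= X)%N](eq_bigl (fun v => (v \in Fs) && (v != u))) => [|v]; last first.
      by rewrite in_setD1 andbC.
    apply: leq_sum => v _; rewrite sum1_card; apply: leq_trans (circle_le v).
    by apply: subset_leq_card; apply/subsetP => x; rewrite !inE => /andP [].
  rewrite sum_nat_const leq_mul2r /=.
  by rewrite leq_subRL // add2n; move: cardFs; rewrite (cardsD1 u Fs) uFs add1n.
rewrite cardsC1 cardK; nia.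
Qed.

End Circles.

Section AbsoluteTrace.
Variable K : finFieldType.
Hypothesis char2 : 2 \in [pchar K].
Variable k : nat.
Let h := k.+1.
Let q := (2 ^ h)%N.
Hypothesis cardK : #|K| = (q ^ 2)%N.

(** The trace to the prime field, with values kept in [K]; there are [h + h] conjugates as |K| =
    2^(2h). Writing [h = k.+1] makes q / 2 available as [2 ^ k]. *)
Definition abs_trace (x : K) : K := \sum_(i < h + h) x ^+ (2 ^ i).

Let two_pow i : [pchar K].-nat (2 ^ i)%N.
Proof. by rewrite pnatX pnatE // char2. Qed.

Lemma abs_traceD x y : abs_trace (x + y) = abs_trace x + abs_trace y.
Proof.
by rewrite /abs_trace -big_split /=; apply: eq_bigr => i _; rewrite exprDn_pchar.
Qed.

(** The sum telescopes to the difference of [z ^+ (q ^ 2)] and [z]. *)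
Lemma abs_trace_artin_schreier z : abs_trace (z ^+ 2 + z) = 0.
Proof.
rewrite abs_traceD /abs_trace addrC -(GRing.subr_pchar2 char2) -sumrB.
under eq_bigr do rewrite -exprM -expnS -opprB.
rewrite sumrN -(big_mkord xpredT (fun i => z ^+ (2 ^ i.+1) - z ^+ (2 ^ i))).
by rewrite telescope_sumr // expnD -/q mulnn -cardK expf_card expr1 subrr oppr0.
Qed.

(* On the circle s ^ q = u / s, so s ^ (q / 2) * abs_trace (kappa * s) is a
   polynomial of degree q in s with leading coefficient kappa ^ (q / 2). *)
Lemma abs_trace_circle (u kappa c : K) : u != 0 -> u ^+ q = u -> kappa != 0 ->
  ~ (forall s, s \in circle q u -> abs_trace (kappa * s) = c).
Proof.
move=> u0 uq kappa0 const.
have qE : q = (2 ^ k + 2 ^ k)%N by rewrite /q /h expnS mul2n addnn.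
have lt_pow i : (i < h)%N -> (2 ^ i <= 2 ^ k)%N by move=> ih; rewrite leq_pexp2l.
(* The second family comes from the conjugates of index [h + i], where [s ^+ (q * 2 ^ i)] equals
   [u ^+ (2 ^ i) / s ^+ (2 ^ i)]. *)
pose P : {poly K} := \sum_(i < h) (kappa ^+ (2 ^ i) *: 'X^(2 ^ i + 2 ^ k)
    + (kappa ^+ (q * 2 ^ i) * u ^+ (2 ^ i)) *: 'X^(2 ^ k - 2 ^ i)) - c *: 'X^(2 ^ k).
have szP : (size P <= q.+1)%N.
  apply/leq_sizeP => j hj; rewrite coefB coefZ coefXn coef_sum big1 => [|i _]; last first.
    have := lt_pow i (ltn_ord i).
    rewrite coefD !coefZ !coefXn => hi.
    have /negPf-> : j != (2 ^ i + 2 ^ k)%N by move: hj; rewrite qE; lia.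
    have /negPf-> : j != (2 ^ k - 2 ^ i)%N by move: hj; rewrite qE; lia.
    by rewrite !mulr0 addr0.
  have /negPf-> : j != (2 ^ k)%N by move: hj; rewrite qE; lia.
  by rewrite mulr0 subr0.
have k0 : (0 < 2 ^ k)%N by rewrite expn_gt0.
have Pq : P`_q = kappa ^+ (2 ^ k).
  rewrite coefB coefZ coefXn coef_sum big_ord_recr big1 => [|i _]; last first.
    have hi : (2 ^ i < 2 ^ k)%N by rewrite ltn_exp2l.
    rewrite coefD !coefZ !coefXn.
    have /negPf-> : q != (2 ^ i + 2 ^ k)%N by rewrite qE; lia.
    have /negPf-> : q != (2 ^ k - 2 ^ i)%N by rewrite qE; lia.
    by rewrite !mulr0 addr0.
  rewrite /= coefD !coefZ !coefXn subnn -qE eqxx mulr1.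
  have /negPf-> : q != 0%N by rewrite qE; lia.
  have /negPf-> : q != (2 ^ k)%N by rewrite qE; lia.
  by rewrite !mulr0 subr0 addr0 add0r.
have P0 : P != 0.
  by apply: contra_neq (expf_neq0 (2 ^ k) kappa0) => P0; rewrite -Pq P0 coef0.
have := leq_trans (card_roots_lt P0 (_ : forall s, s \in circle q u -> P.[s] = 0)) szP.
rewrite ltnS leqNgt card_circle // => H; suff : false by []; apply: H => s su.
rewrite -(mulr0 (s ^+ (2 ^ k))) -(subrr c) -{1}(const s su) /abs_trace.
rewrite big_split_ord /= -big_split /= mulrBr mulr_sumr.
rewrite hornerD hornerN hornerZ hornerXn [c * _]mulrC; congr (_ - _).
rewrite horner_sum; apply: eq_bigr => i _.
rewrite hornerD !hornerZ !hornerXn mulrDr; congr (_ + _).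
  by rewrite exprMn exprD; ring.
have norm_s : s * s ^+ q = u by move: su; rewrite inE => /eqP <-; rewrite /qnorm exprS.
rewrite expnD -/q exprMn -norm_s exprMn.
have -> : s ^+ (2 ^ k) = s ^+ (2 ^ k - 2 ^ i) * s ^+ (2 ^ i).
  by rewrite -exprD subnK // lt_pow.
by rewrite (exprM s q); ring.
Qed.

End AbsoluteTrace.

(* On a circle minus one point the product of the two affine functions vanishes,
   so one of them is identically zero. *)
Lemma affine_dichotomy (F : finFieldType) (S : {set F}) (x0 e alpha beta : F) :
    (3 < #|S|)%N ->
    (forall x, x \in S -> x != x0 ->
       alpha + beta * x = 0 \/ alpha + beta * x = e * (x - x0)) ->
  (forall x, alpha + beta * x = 0) \/ (forall x, alpha + beta * x = e * (x - x0)).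
Proof.
move=> cardS zeroS; pose P : {poly F} := alpha%:P + beta *: 'X.
pose Q : {poly F} := P - e *: ('X - x0%:P).
have PE x : P.[x] = alpha + beta * x by rewrite hornerD hornerC hornerZ hornerX.
have QE x : Q.[x] = P.[x] - e * (x - x0).
  by rewrite hornerD hornerN hornerZ hornerD hornerN hornerX hornerC.
have szP : (size P <= 2)%N.
  rewrite (leq_trans (size_polyD _ _)) // geq_max (leq_trans (size_polyC_leq1 _)) //.
  by rewrite (leq_trans (size_scale_leq _ _)) // size_polyX.
have szQ : (size Q <= 2)%N.
  rewrite (leq_trans (size_polyD _ _)) // geq_max szP size_polyN.
  by rewrite (leq_trans (size_scale_leq _ _)) // size_XsubC.
have PQ0 : P * Q = 0.
  apply: contraTeq cardS => nPQ; rewrite -leqNgt.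
  have zPQ x : x \in S :\ x0 -> (P * Q).[x] = 0.
    rewrite hornerM QE PE => /setD1P [nx xS].
    by case: (zeroS x xS nx) => ->; rewrite ?mul0r // subrr mulr0.
  have := leq_trans (card_roots_lt nPQ zPQ) (size_polyMleq P Q).
  have := cardsD1 x0 S; move: szP szQ; case: (x0 \in S); lia.
move/eqP: PQ0; rewrite mulf_eq0 => /orP [] /eqP z; [left|right] => x.
  by rewrite -PE z horner0.
by apply/eqP; rewrite -subr_eq0 -PE -QE z horner0.
Qed.

(* K = GF(q^2), q = 2^h; GF(q)^* = {u | u != 0, u^q = u};
   |U| < q/4 - 1  <=>  4|U| + 4 < q. *)
Theorem theorem1p2 (K : finFieldType) (h : nat) (U : {set K}) :
  (1 < h)%N ->
  #|K| = ((2 ^ h) ^ 2)%N ->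
  U != set0 ->
  (forall u, u \in U -> u != 0 /\ u ^+ (2 ^ h) = u) ->
  (4 * #|U| + 4 < 2 ^ h)%N ->
  forall Om : {set K * K},
    regular_hyperoval_AG Om -> ~ marc (2 ^ h) U (affset Om).
Proof.
case: h => // k k0 cardK /set0Pn [u uU] UF cardU Om Om_reg arc.
have [u0 uq] := UF u uU.
have char2 : 2 \in [pchar K] by apply: (@card_finPcharP _ 2 (k.+1 * 2)); rewrite // expnM.
have [a [b [d [g [x0 [y0 [an g0 OmE]]]]]]] := regular_hyperoval_normal_form char2 Om_reg.
have [a0 b0 d0] := anisotropic_neq0 char2 an.
have card_Om := card_conic_nucleus char2 an g0 OmE.
have arc0 : marc (2 ^ k.+1) set0 (affset Om) by exact: (conic_nucleus_arc char2 an OmE).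
have q_pow : [pchar K].-nat (2 ^ k.+1)%N by rewrite pnatX pnatE // char2.
have q_even : ~~ odd (2 ^ k.+1) by rewrite oddX.
have circle_card := card_circle cardK u0 uq.
set q := (2 ^ k.+1)%N in circle_card cardK q_pow q_even arc arc0 cardU uq.
pose A := [set p in Om | qnorm q p.1 \in U].
have sum_frob (phi : K -> K) m :
    \sum_(p in A) phi (p.2 + m * p.1) = \sum_(p in A) phi (p.2 + m ^+ q * p.1).
  (* Both planes give a zero sum over [Om]; the terms with norm outside [U] agree and cancel. *)
  have := etrans (sum_lines_eq0 char2 q_pow cardK arc card_Om phi m)
    (esym (sum_lines_eq0 char2 q_pow cardK arc0 card_Om phi m)).
  rewrite [LHS](bigID (fun p => qnorm q p.1 \in U)) [RHS](bigID (fun p => qnorm q p.1 \in U)) /=.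
  have -> : \sum_(p in Om | qnorm q p.1 \notin U) phi (p.2 - odot q U m p.1)
      = \sum_(p in Om | qnorm q p.1 \notin U) phi (p.2 - odot q set0 m p.1).
    by apply: eq_bigr => p /andP [_ /negPf pU]; rewrite /odot pU inE.
  move/addIr => e; rewrite (eq_bigl (fun p => (p \in Om) && (qnorm q p.1 \in U))); last by move=> p; rewrite inE.
  rewrite [RHS](eq_bigl (fun p => (p \in Om) && (qnorm q p.1 \in U))); last by move=> p; rewrite inE.
  transitivity (\sum_(p in Om | qnorm q p.1 \in U) phi (p.2 - odot q set0 m p.1)).
    by apply: eq_bigr => p _; rewrite /odot inE (GRing.subr_pchar2 char2).
  by rewrite -e; apply: eq_bigr => p /andP [_ pU]; rewrite /odot pU (GRing.subr_pchar2 char2).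
have U0 v : v \in U -> v != 0 by case/UF.
have A_U p : p \in A -> qnorm q p.1 \in U by rewrite inE => /andP [].
have [alpha [beta affA]] := column_sum_affine char2 q_pow q_even cardK sum_frob U0 cardU A_U uU.
have aff x : x \in circle q u -> \sum_(y | (x, y) \in Om) y = alpha + beta * x.
  rewrite inE => /eqP xu; rewrite -affA //; apply: eq_bigl => y.
  by rewrite inE /= xu uU andbT.
have [s sE] := char2_sqrt char2 (b * g).
have s0 : s != 0.
  by apply: contra_neq (mulf_neq0 b0 g0) => s0; rewrite -sE s0 expr0n.
have col x : x \in circle q u -> x != x0 -> alpha + beta * x =
    if [exists z, z ^+ 2 + z == a * b / d ^+ 2 + s / d / (x - x0)]
    then d / b * (x - x0) else 0.
  by move=> xu nx; rewrite -aff // (conic_nucleus_column char2 an OmE sE nx).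
have aff_cases : (forall x, alpha + beta * x = 0) \/
    (forall x, alpha + beta * x = d / b * (x - x0)).
  apply: (@affine_dichotomy _ (circle q u)) => [|x xu nx].
    by apply: leq_trans circle_card; move: cardU; lia.
  by rewrite col //; case: ifP; [right | left].
(* Both candidate affine functions vanish at [x0], while the column sum there is nonzero. *)
have [x0u|x0u] := boolP (x0 \in circle q u).
  have /negP := conic_nucleus_column_nucleus char2 an g0 OmE; apply.
  by rewrite aff //; case: aff_cases => ->; rewrite ?subrr ?mulr0.
have x_neq x : x \in circle q u -> x != x0 by apply: contraTneq => ->.
(* A root [z] would make [(1, d * z / b)] isotropic. *)
have ab_nroot z : z ^+ 2 + z <> a * b / d ^+ 2.
  move=> zE; have [] := an 1 (d * z / b); last by move/eqP; rewrite oner_eq0.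
  apply: (char2_eq char2 (e := a)).
  transitivity (a + d ^+ 2 / b * (z ^+ 2 + z)); first by rewrite /bform; field.
  by rewrite zE; field; rewrite b0 d0.
have [c trace_c] : exists c, forall x, x \in circle q u -> abs_trace k (s / d / (x - x0)) = c.
  (* Zero sums mean empty columns: then [s / d / (x - x0)] is a sum of two elements outside the
     Artin-Schreier image and has trace 0. Otherwise all columns are nonempty and its trace is that
     of [a * b / d ^+ 2]. *)
  case: aff_cases => affE.
    exists 0 => x xu; have := col x xu (x_neq x xu); rewrite affE.
    case: ifP => [_ /esym/eqP|/negbT/existsPn nz _].
      by rewrite !mulf_eq0 invr_eq0 (negPf d0) (negPf b0) subr_eq0 (negPf (x_neq x xu)).
    have nz' z : z ^+ 2 + z <> a * b / d ^+ 2 + s / d / (x - x0).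
      by apply/eqP.
    have [z zE] := char2_artin_schreier_index2 char2 ab_nroot nz'.
    have <- : z ^+ 2 + z = s / d / (x - x0).
      by rewrite zE addrA (addrr_pchar2 char2) add0r.
    exact: abs_trace_artin_schreier.
  exists (abs_trace k (a * b / d ^+ 2)) => x xu; have := col x xu (x_neq x xu); rewrite affE.
  case: ifP => [/existsP [z /eqP zE] _|_ /eqP].
    have := abs_trace_artin_schreier char2 cardK z; rewrite zE abs_traceD // => /eqP.
    by rewrite addr_eq0 (GRing.oppr_pchar2 char2) => /eqP.
  by rewrite !mulf_eq0 invr_eq0 (negPf d0) (negPf b0) subr_eq0 (negPf (x_neq x xu)).
(* Inversion maps the circle x ^ (q+1) = u, translated by x0, to another circle:
   x = x0 + 1 / v with v = (t + x0 ^ q) / D runs over it as t does. *)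
pose D := qnorm q x0 + u.
have D0 : D != 0.
  by rewrite addr_eq0 (GRing.oppr_pchar2 char2); move: x0u; rewrite inE.
(* [s / d * v] is affine in [t]; its constant term accounts for the trace subtracted from [c]. *)
apply: (@abs_trace_circle K char2 k cardK u (s / d / D) (c - abs_trace k (s / d / D * x0 ^+ q))) => //.
  by rewrite !mulf_neq0 ?invr_eq0.
move=> t tu; have tuE : t ^+ q * t = u by move: tu; rewrite inE => /eqP <-; rewrite /qnorm exprSr.
pose v := (t + x0 ^+ q) / D.
have Dv : D * v = t + x0 ^+ q by rewrite mulrC divfK.
have nz_v : v != 0.
  apply: contraNneq x0u => nz_v; move: Dv; rewrite nz_v mulr0 => /esym/eqP.
  rewrite addr_eq0 (GRing.oppr_pchar2 char2) => /eqP tE.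
  by move: tu; rewrite !inE tE (qnorm_frob cardK).
have xu : x0 + v^-1 \in circle q u.
  (* Multiplying by [D * v] turns [x0 + v^-1] into [t * (x0 + t ^+ q)], whose second factor is
     conjugate to [D * v] and so has the same norm. *)
  have vn0 : qnorm q (D * v) != 0 by rewrite expf_neq0 // mulf_neq0.
  rewrite inE; apply/eqP; apply: (mulIf vn0); rewrite -qnormM.
  have -> : (x0 + v^-1) * (D * v) = t * (x0 + t ^+ q).
    transitivity (x0 * (D * v) + D); first by field.
    rewrite Dv; apply: (char2_eq char2 (e := qnorm q x0)).
    by rewrite /D -tuE /qnorm exprSr; ring.
  rewrite qnormM; move: tu; rewrite inE => /eqP ->; congr (_ * _).
  rewrite Dv -(qnorm_frob cardK (t + _)) (exprDn_pchar _ _ q_pow) (expf_qq cardK).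
  by rewrite addrC.
rewrite -(trace_c _ xu) [x0 + _]addrC addrK invrK.
have -> : s / d * v = s / d / D * t + s / d / D * x0 ^+ q by rewrite /v; field; rewrite D0 d0.
by rewrite abs_traceD // addrK.
Qed.
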